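(* For $\theta>0$, let $C^{\mathrm{Cl}}_\theta(u,v)=\left(u^{-\theta}+v^{-\theta}-1\right)^{-1/\theta}$ be the Clayton copula. Then Chatterjee's rank correlation of $C^{\mathrm{Cl}}_\theta$ is $$\xi\left(C^{\mathrm{Cl}}_\theta\right)=6\int_0^1{}_2F_1\left(\frac1\theta,\,2+\frac2\theta;\,1+\frac1\theta,\,1-v^{-\theta}\right)dv-2.$$
   Context: For a bivariate copula $C$, Chatterjee's rank correlation is $\xi(C)=6\int_0^1\int_0^1(\partial_1C(u,v))^2\,du\,dv-2$, where $\partial_1C$ is the (almost everywhere defined) partial derivative of $C$ with respect to its first argument. The hypergeometric function is $${}_2F_1(a,b;c,z)=\frac{\Gamma(c)}{\Gamma(a)\Gamma(c-a)}\int_0^1w^{a-1}(1-w)^{c-a-1}(1-wz)^{-b}\,dw,$$ where $\Gamma$ is the gamma function. *)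

(* Defs.v *)
From HB Require Import structures.
From mathcomp Require Import all_boot all_order all_algebra.
From mathcomp Require Import all_classical all_reals all_analysis.

Set Implicit Arguments.
Unset Strict Implicit.
Unset Printing Implicit Defensive.

Import Order.TTheory GRing.Theory Num.Theory.
Import numFieldNormedType.Exports.

Local Open Scope classical_set_scope.
Local Open Scope ring_scope.

(* All integrals below are Lebesgue integrals over the open interval: the
   endpoints are negligible, and at an endpoint the integrand may be undefined
   (negative power of 0, derivative at the border of the unit square). *)

(* Meaningful for x > 0. *)
Definition Gamma (R : realType) (x : R) : R :=
  \int[lebesgue_measure]_(t in `]0, +oo[) (t `^ (x - 1) * expR (- t)).

(* Euler's integral representation, meaningful for 0 < a < c and z < 1; a and b
   are exchanged with respect to the most common form of the integral (the
   function is symmetric in a and b). *)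
Definition hyp2F1 (R : realType) (a b c z : R) : R :=
  Gamma c / (Gamma a * Gamma (c - a)) *
  \int[lebesgue_measure]_(w in `]0, 1[)
     (w `^ (a - 1) * (1 - w) `^ (c - a - 1) * (1 - w * z) `^ (- b)).

Definition partial1 (R : realType) (C : R -> R -> R) (u v : R) : R :=
  derive1 (fun t => C t v) u.

(* A bivariate copula is given as a function R -> R -> R, of which only the
   values on the unit square matter. At points of non-differentiability (a
   null set, for a copula) partial1 takes an unspecified value. *)
Definition chatterjee_xi (R : realType) (C : R -> R -> R) : R :=
  6 * (\int[lebesgue_measure]_(v in `]0, 1[)
         \int[lebesgue_measure]_(u in `]0, 1[) (partial1 C u v ^+ 2)) - 2.

(* On the axes u = 0 and v = 0 the formula is read as its limit, 0; this is made
   explicit because 0 `^ (- theta) = 0 in the library. *)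
Definition clayton (R : realType) (theta u v : R) : R :=
  if (u == 0) || (v == 0) then 0
  else (u `^ (- theta) + v `^ (- theta) - 1) `^ (- (1 / theta)).

(* Main.v *)
(* On the open unit square the partial derivative satisfies
   (d_1 C)^2 = (1 - u^theta z)^(-(2 + 2/theta)) with z = 1 - v^(-theta) <= 0.
   The substitution u = w^(1/theta) turns the integral over u into
   (1/theta) times Euler's integral with a = 1/theta, b = 2 + 2/theta and
   c = a + 1, whose prefactor Gamma(a+1) / (Gamma(a) Gamma(1)) is a. Since
   w^(1/theta) may be singular at 0, the substitution is made on [e, r] and
   passed to the limit by monotone convergence. *)

Require Import Defs.
From mathcomp Require Import all_boot all_order all_algebra.
From mathcomp Require Import all_classical all_reals all_analysis.
From mathcomp Require Import measurable_realfun.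
From mathcomp Require Import ring.

Import Order.TTheory GRing.Theory Num.Theory.
Import numFieldNormedType.Exports.

Local Open Scope classical_set_scope.
Local Open Scope ring_scope.

(** * Power substitution on half-open intervals at 0 *)

Section power_substitution.
Variable R : realType.
Notation mu := (@lebesgue_measure R).

(* The library's [measurable_powR], restated over the measurable structure
   inferred for [R], with which [measurableT_comp] unifies. *)
Lemma measurable_powRl (p : R) : measurable_fun [set: R] (fun x => x `^ p).
Proof. by []. Qed.

(** Monotone convergence in the domain: the intervals [[e n, r]] increase with [n] and their union
    is []0, r]]. *)
Lemma cvg_integral_oc (f : R -> \bar R) (e : R^nat) (r : R) :
  measurable_fun setT f -> (forall x, 0 < x -> (0 <= f x)%E) ->
  (forall n, 0 < e n) -> nonincreasing_seq e -> e @ \oo --> 0 ->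
  (\int[mu]_(x in `[e n, r]) f x)%E @[n --> \oo] -->
  (\int[mu]_(x in `]0%R, r]) f x)%E.
Proof.
move=> mf f0 e0 ndec e_cvg0.
rewrite (_ : `]0, r]%classic = \bigcup_n `[e n, r]%classic); last first.
  apply/seteqP; split => [x|x [n _]]/=; rewrite !in_itv/=.
    move=> /andP[x0 xr].
    have [n _ /(_ n (leqnn n))/= enx] : \forall n \near \oo, e n < x.
      exact: (cvgr_lt 0).
    by exists n => //=; rewrite in_itv/= xr ltW.
  by move=> /andP[/(lt_le_trans (e0 n)) -> ->].
apply: ge0_nondecreasing_set_cvg_integral.
- move=> n m nm; rewrite subsetEset => x/=; rewrite !in_itv/= => /andP[enx ->].
  by rewrite andbT (le_trans _ enx)// ndec.
- by [].
- by move=> n; exact: measurable_funTS.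
- by move=> n x/=; rewrite in_itv/= => /andP[/(lt_le_trans (e0 n)) /f0].
Qed.

(** For [p < 1] the factor [p * x ^ (p - 1)] blows up at 0, so the classical substitution rule is
    applied away from 0 and both sides are then exhausted by [cvg_integral_oc]. *)
Lemma ge0_integral_powR_substitution (p r : R) (G : R -> R) :
  0 < p -> 0 < r -> measurable_fun setT G ->
  {in `]0, +oo[, continuous G} -> (forall x, 0 < x -> 0 <= G x) ->
  (\int[mu]_(x in `]0%R, (r `^ p)%R]) (G x)%:E =
   \int[mu]_(x in `]0%R, r]) (G (x `^ p) * (p * x `^ (p - 1)))%:E)%E.
Proof.
move=> p0 r0 mG cG G0.
(* The factor [r] keeps every cut-off in []0, r]]. *)
pose e n := r * harmonic n.
have e0 n : 0 < e n by rewrite /e mulr_gt0 ?harmonic_gt0.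
have endec : nonincreasing_seq e.
  move=> m n mn; rewrite /e ler_pM2l// lef_pV2 ?posrE//.
  by rewrite ler_nat.
have ecvg : e @ \oo --> 0.
  by rewrite -(mulr0 r); apply: cvgM; [exact: cvg_cst|exact: cvg_harmonic].
have er n : e n <= r.
  by rewrite /e ger_pMr// invf_le1// ler1n.
have cpowR q x : 0 < x -> {for x, continuous (fun y : R => y `^ q)}.
  move=> x0; apply: differentiable_continuous.
  by apply/derivable1_diffP/derivable_powR; rewrite in_itv/= x0.
pose ep n := e n `^ p.
have L : (\int[mu]_(x in `[ep n, (r `^ p)%R]) (G x)%:E)%E @[n --> \oo] -->
    (\int[mu]_(x in `]0%R, (r `^ p)%R]) (G x)%:E)%E.
  apply: cvg_integral_oc.
  - exact/measurable_EFinP.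
  - by move=> x x0; rewrite lee_fin G0.
  - by move=> n; rewrite powR_gt0.
  - by move=> m n mn; rewrite ge0_ler_powR ?nnegrE ?(ltW p0) ?(ltW (e0 _)) ?endec.
  (* The cut-offs are positive, so the limit from the right of the power at 0 is enough. *)
  - by apply: (cvg_at_rightP (fun x => x `^ p) 0 0).1 => //; exact: powR_cvg0.
have M : (\int[mu]_(x in `[e n, r])
      (G (x `^ p) * (p * x `^ (p - 1)))%:E)%E @[n --> \oo] -->
    (\int[mu]_(x in `]0%R, r]) (G (x `^ p) * (p * x `^ (p - 1)))%:E)%E.
  apply: cvg_integral_oc => //.
  - apply/measurable_EFinP; apply: measurable_funM.
      exact: measurableT_comp.
    exact: measurable_funM.
  - move=> x x0; rewrite lee_fin mulr_ge0 ?G0 ?powR_gt0//.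
    by rewrite mulr_ge0 ?powR_ge0// ltW.
have LM n : (\int[mu]_(x in `[ep n, (r `^ p)%R]) (G x)%:E)%E =
  (\int[mu]_(x in `[e n, r]) (G (x `^ p) * (p * x `^ (p - 1)))%:E)%E.
  have pos x : e n <= x -> 0 < x by exact: lt_le_trans.
  have cpowR' x : 0 < x ->
      {for x, continuous (fun y : R => y `^ p)^`()%classic}.
    move=> x0; have : {for x, continuous (fun y : R => p * y `^ (p - 1))}.
      by apply: cvgM; [exact: cvg_cst|exact: cpowR].
    (* The closed form of the derivative is valid only at positive points, so continuity is
       transferred along a neighbourhood of [x] inside the positive reals. *)
    rewrite /prop_for /continuous_at powR_derive1 ?in_itv/= ?x0//.
    apply: cvg_trans; apply: near_eq_cvg; near=> y.
    by rewrite powR_derive1// in_itv/= andbT; near: y; exact: lt_nbhsr.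
  rewrite /ep (@integration_by_substitution_increasing _ (fun y => y `^ p))//.
  - apply: eq_integral => x; rewrite inE/= in_itv/= => /andP[/pos x0 _].
    by rewrite fctE powR_derive1// in_itv/= x0.
  - move=> x y; rewrite !in_itv/= => /andP[/pos x0 _] /andP[/pos y0 _] xy.
    by rewrite gt0_ltr_powR// nnegrE ltW.
  - move=> x; rewrite in_itv/= => /andP[/ltW/pos x0 _]; exact: cpowR'.
  - by apply: (cvgP _); apply/cvg_at_right_filter/cpowR'.
  - by apply: (cvgP _); apply/cvg_at_left_filter/cpowR'.
  - split.
    + move=> x; rewrite in_itv/= => /andP[/ltW/pos x0 _].
      by apply: derivable_powR; rewrite in_itv/= x0.
    + exact/cvg_at_right_filter/cpowR.
    + exact/cvg_at_left_filter/cpowR.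
  - apply: continuous_in_subspaceT => x; rewrite inE/= in_itv/= => /andP[x0 _].
    by apply: cG; rewrite in_itv/= andbT (lt_le_trans _ x0)// powR_gt0.
move: L; rewrite (funext LM) => L; exact: cvg_unique L M.
Unshelve. all: by end_near. Qed.
End power_substitution.

(* No finiteness is needed: [fine] sends both infinities to 0. *)
Lemma fine_gt0_mulEFin (R : realType) (a : R) (x : \bar R) :
  0 < a -> fine (a%:E * x)%E = a * fine x.
Proof.
move=> a0; case: x => [r||]//; rewrite ?gt0_muley ?gt0_muleNy ?lte_fin//=.
  by rewrite mulr0.
by rewrite mulr0.
Qed.

(** * Recurrence, finiteness and positivity of the gamma function *)

Section gamma.
Variable R : realType.
Notation mu := (@lebesgue_measure R).
Implicit Types a s t : R.

Lemma integral_expRN s :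
  (\int[mu]_(t in `[s, +oo[) (expR (- t))%:E = (expR (- s))%:E)%E.
Proof.
have cexpN : continuous (fun t : R => expR (- t)).
  move=> t; apply: continuous_comp; last exact: continuous_expR.
  exact: continuousN.
(* The last argument 0 is the limit of the antiderivative at infinity. *)
rewrite (@ge0_continuous_FTC2y _ _ (fun t => - expR (- t)) _ 0)//.
- by rewrite sub0e EFinN oppeK.
- exact: continuous_subspaceT.
- by rewrite -oppr0; apply: cvgN; exact: cvgr_expR.
- by apply: cvgN; exact/cvg_at_right_filter/cexpN.
- move=> t _; rewrite derive1E.
  by rewrite derive_val /GRing.scale/= mulrN1 opprK.
Qed.

(** The substitution lemma for the constant function 1, whose integral over []0, t ^ a]] is a
    length; this covers [a < 1], where the integrand is singular at 0. *)
Lemma integral_powR_oc a t : 0 < a -> 0 < t ->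
  (\int[mu]_(s in `]0%R, t]) (a * s `^ (a - 1))%:E = (t `^ a)%:E)%E.
Proof.
move=> a0 t0.
have <- : (\int[mu]_(s in `]0%R, (t `^ a)%R]) (cst 1 s)%:E)%E = (t `^ a)%:E.
  rewrite (integral_cst mu _ 1%E)//= lebesgue_measure_itv/= lte_fin powR_gt0//.
  by rewrite oppr0 adde0 mul1e.
rewrite (@ge0_integral_powR_substitution R a t (cst 1))//.
  by apply: eq_integral => s _; rewrite /= mul1r.
by move=> x _; exact: cvg_cst.
Qed.

(** Extended-real version of [Gamma], to which Tonelli and monotonicity apply before finiteness is
    known. *)
Definition egamma a :=
  (\int[mu]_(t in `]0%R, +oo[) (t `^ (a - 1) * expR (- t))%:E)%E.

Lemma measurable_gamma_integrand a :
  measurable_fun [set: R] (fun t => t `^ (a - 1) * expR (- t)).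
Proof.
by apply: measurable_funM => //; apply: measurableT_comp.
Qed.

Lemma egamma_ge0 a : (0 <= egamma a)%E.
Proof.
by apply: integral_ge0 => t _; rewrite lee_fin mulr_ge0 ?powR_ge0 ?expR_ge0.
Qed.

(* Tonelli applied to a s^(a-1) e^(-t) over 0 < s <= t. *)
Lemma egammaD1 a : 0 < a -> egamma (a + 1) = (a%:E * egamma a)%E.
Proof.
move=> a0.
pose D := [set z : R * R | 0 < z.1 /\ z.1 <= z.2].
pose f (z : R * R) := (a * z.1 `^ (a - 1) * expR (- z.2) * \1_D z)%:E.
have f0 z : (0 <= f z)%E.
  rewrite lee_fin !mulr_ge0 ?powR_ge0 ?expR_ge0 ?(ltW a0)//.
have mD : measurable D.
  rewrite (_ : D = (fun z => (0 < z.1) && (z.1 <= z.2)) @^-1` [set true]).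
    rewrite -[X in measurable X]setTI.
    apply: (measurable_and (measurable_fun_ltr _ _) (measurable_fun_ler _ _)) => //.
  by apply/seteqP; split => z /= => [[-> ->]|/andP[]].
have mf : measurable_fun setT f.
  apply/measurable_EFinP; apply: measurable_funM; last exact: measurable_indic.
  apply: measurable_funM.
    apply: measurable_funM => //.
    exact: (measurableT_comp (measurable_powRl R (a - 1)) measurable_fst).
  do 2 apply: measurableT_comp => //.
have := @fubini_tonelli _ _ _ _ R mu mu f mf f0.
rewrite /egamma -ge0_integralZl//; last 3 first.
- by apply/measurable_EFinP/measurable_funTS; exact: measurable_gamma_integrand.
- by move=> t _; rewrite lee_fin mulr_ge0 ?powR_ge0 ?expR_ge0.
- by rewrite lee_fin ltW.
rewrite [in X in _ -> X](_ : a + 1 - 1 = a) ?addrK//.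
(* Integrating in [s] first: the slice of [D] at [t] is []0, t]], which contributes [t ^ a], and it
   is empty for [t <= 0]. *)
rewrite [X in _ = X -> _](_ : _ =
    (\int[mu]_(t in `]0%R, +oo[) (t `^ a * expR (- t))%:E)%E); last first.
  rewrite [RHS]integral_mkcond; apply: eq_integral => t _.
  rewrite patchE; case: ifPn; rewrite ?inE ?notin_setE/= in_itv/= andbT => t0.
    rewrite EFinM -integral_powR_oc// muleC -ge0_integralZl//; last 2 first.
    - by apply/measurable_EFinP; apply: measurable_funTS; exact: measurable_funM.
    - by move=> s _; rewrite lee_fin mulr_ge0 ?powR_ge0// ltW.
    rewrite [RHS]integral_mkcond; apply: eq_integral => s _.
    rewrite patchE; case: ifPn; rewrite ?inE ?notin_setE/= in_itv/= => st.
      by rewrite /f indicE mem_set ?mulr1 -?EFinM 1?mulrC//; exact/andP.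
    by rewrite /f indicE memNset ?mulr0// => -[] /= ? ?; apply: st; exact/andP.
  apply: integral0_eq => s _; rewrite /f indicE memNset ?mulr0// => -[]/= s0 st.
  by apply: t0; exact: lt_le_trans st.
(* Integrating in [t] first: the slice of [D] at [s > 0] is [[s, +oo[], over which [expR (- t)]
   integrates to [expR (- s)]. *)
move=> <-; rewrite [RHS]integral_mkcond; apply: eq_integral => s _.
rewrite patchE; case: ifPn; rewrite ?inE ?notin_setE/= in_itv/= andbT => s0.
  rewrite EFinM muleA -integral_expRN -ge0_integralZl//; last 2 first.
  - apply/measurable_EFinP; apply: measurable_funTS.
    by do 2 apply: measurableT_comp => //.
  - by rewrite lee_fin mulr_ge0 ?powR_ge0// ltW.
  rewrite [RHS]integral_mkcond; apply: eq_integral => t _.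
  rewrite patchE; case: ifPn; rewrite ?inE ?notin_setE/= in_itv/= andbT => st.
    by rewrite /f indicE mem_set ?mulr1 -?EFinM.
  by rewrite /f indicE memNset ?mulr0// => -[].
by apply: integral0_eq => t _; rewrite /f indicE memNset ?mulr0// => -[].
Qed.

Lemma egamma1 : egamma 1 = 1%E.
Proof.
rewrite /egamma; under eq_integral do rewrite subrr powRr0 mul1r.
rewrite integral_itv_obnd_cbnd ?integral_expRN ?oppr0 ?expR0//.
apply/measurable_EFinP; apply: measurable_funTS.
by do 2 apply: measurableT_comp => //.
Qed.

Lemma egamma_natS n : (egamma n.+1%:R < +oo)%E.
Proof.
elim: n => [|n IHn]; first by rewrite egamma1 ltry.
by rewrite -natr1 egammaD1 ?ltr0n// lte_mul_pinfty// lee_fin.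
Qed.

(** By the recurrence it suffices to treat [a + 1], whose integrand is not singular at 0. There
    [t ^ a <= 1 + t ^ n] for an integer [n >= a], which gives the bound
    [egamma 1 + egamma (n + 1)]. *)
Lemma egamma_lty a : 0 < a -> (egamma a < +oo)%E.
Proof.
move=> a0; suff : (egamma (a + 1) < +oo)%E.
  rewrite egammaD1//; have := egamma_ge0 a; case: (egamma a) => [r _ _|_|//].
    by rewrite ltry.
  by rewrite gt0_muley// lte_fin.
pose n := (Num.trunc a).+1.
have an : a <= n%:R by rewrite ltW// truncnS_gt.
have : (egamma (1 : R) + egamma (n%:R + 1)%R < +oo)%E.
  by rewrite natr1 lte_add_pinfty// ?egamma1 ?ltry// egamma_natS.
apply: le_lt_trans.
have m b : measurable_fun (`]0, +oo[ : set R)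
    (fun t => (t `^ (b - 1) * expR (- t))%:E).
  by apply/measurable_EFinP/measurable_funTS; exact: measurable_gamma_integrand.
have ge0 b t : (0 <= (t `^ (b - 1) * expR (- t))%:E)%E.
  by rewrite lee_fin mulr_ge0 ?powR_ge0 ?expR_ge0.
rewrite -ge0_integralD//; [|exact: m..].
apply: ge0_le_integral => //; [exact: m|by apply: emeasurable_funD; exact: m|].
move=> t /=; rewrite in_itv/= andbT => t0.
rewrite -EFinD lee_fin -mulrDl ler_pM2r ?expR_gt0// !addrK subrr powRr0.
(* Below 1 the summand 1 dominates [t ^ a], above 1 the summand [t ^ n] does. *)
have [t1|/ltW t1] := leP t 1.
  by rewrite ler_wpDr ?powR_ge0// -[leRHS](powRr0 t) ger_powR ?t0// ltW.
by rewrite ler_wpDl// ler_powR.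
Qed.

(** After the shift to [a + 1], the part of the integral over [[1, +oo[] already exceeds or equals
    [expR (- 1)], because [t ^ a >= 1] there. *)
Lemma egamma_gt0 a : 0 < a -> (0 < egamma a)%E.
Proof.
move=> a0; suff : (0 < egamma (a + 1))%E.
  by rewrite egammaD1// pmule_rgt0// lte_fin.
apply: (@lt_le_trans _ _ (expR (- 1))%:E); first by rewrite lte_fin expR_gt0.
rewrite -integral_expRN.
apply: (@le_trans _ _
  (\int[mu]_(t in `[1%R, +oo[) (t `^ (a + 1 - 1) * expR (- t))%:E)%E).
  apply: ge0_le_integral => //.
  - apply/measurable_EFinP; apply: measurable_funTS.
    by do 2 apply: measurableT_comp => //.
  - by apply/measurable_EFinP/measurable_funTS; exact: measurable_gamma_integrand.
  - move=> t /=; rewrite in_itv/= andbT => t1.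
    by rewrite lee_fin ler_peMl ?expR_ge0// addrK -(powRr0 t) ler_powR// ltW.
apply: ge0_subset_integral => //.
- by apply/measurable_EFinP/measurable_funTS; exact: measurable_gamma_integrand.
- by move=> t _; rewrite lee_fin mulr_ge0 ?powR_ge0 ?expR_ge0.
- by move=> t/=; rewrite !in_itv/= !andbT; exact: lt_le_trans.
Qed.

Lemma GammaE a : Gamma a = fine (egamma a).
Proof. by []. Qed.

Lemma GammaD1 a : 0 < a -> Gamma (a + 1) = a * Gamma a.
Proof.
by move=> a0; rewrite !GammaE egammaD1// fine_gt0_mulEFin.
Qed.

Lemma Gamma_gt0 a : 0 < a -> 0 < Gamma a.
Proof. by move=> a0; rewrite GammaE fine_gt0// egamma_gt0// egamma_lty. Qed.

Lemma Gamma1 : Gamma (1 : R) = 1.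
Proof. by rewrite GammaE egamma1. Qed.
End gamma.

(** * The Clayton copula and its inner integral *)

Section clayton.
Variables (R : realType) (theta : R).
Hypothesis theta_gt0 : 0 < theta.
Notation mu := (@lebesgue_measure R).
Implicit Types u v z : R.

(** Makes the bases of the later powers positive: it yields both
    [u ^ (- theta) + v ^ (- theta) - 1 > 0] and [1 - v ^ (- theta) <= 0]. *)
Lemma powRN_ge1 v : 0 < v < 1 -> 1 <= v `^ (- theta).
Proof.
move=> /andP[v0 v1]; rewrite powRN invf_ge1 ?powR_gt0//.
by rewrite -(powRr0 v) ger_powR ?v0 ?ltW.
Qed.

Lemma partial1_clayton u v : 0 < u < 1 -> 0 < v < 1 ->
  partial1 (clayton theta) u v =
  (u `^ (- theta) + v `^ (- theta) - 1) `^ (- (1 / theta) - 1) *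
  u `^ (- theta - 1).
Proof.
move=> u01 v01; have /andP[u0 _] := u01; have /andP[v0 _] := v01.
rewrite /partial1 derive1E.
pose h (t : R) := t `^ (- theta) + (v `^ (- theta) - 1).
have hu0 : 0 < h u.
  by rewrite /h ltr_wpDr ?powR_gt0// subr_ge0 powRN_ge1.
(* Near [u > 0] the argument stays nonzero, so the branch of [clayton] on the axes is avoided. *)
rewrite (@near_eq_derive _ _ _ _ (fun t => (h t) `^ (- (1 / theta)))); last first.
  near=> t; rewrite /clayton /h addrA !gt_eqF//; near: t; exact: lt_nbhsr.
have dh : is_derive u (1 : R) h (- theta * u `^ (- theta - 1)).
  rewrite /h -[X in is_derive _ _ _ X]addr0.
  by apply: is_deriveD; exact: is_derive1_powR.
have /@derive_val -> := @is_derive1_comp _ (fun y => y `^ (- (1 / theta)))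
  h u _ _ (is_derive1_powR _ hu0) dh.
rewrite -[h u]/(u `^ (- theta) + (v `^ (- theta) - 1)) addrA.
rewrite /GRing.scale/=; field.
by rewrite gt_eqF.
Unshelve. all: by end_near. Qed.

(** Factoring [u ^ theta] out of the base on the right leaves [u ^ (- theta) + v ^ (- theta) - 1].
    The exponents then match: [2 * (- 1 / theta - 1)] is [- (2 + 2 / theta)], and [theta] times the
    latter is [2 * (- theta - 1)]. *)
Lemma partial1_clayton_sqr u v : 0 < u < 1 -> 0 < v < 1 ->
  partial1 (clayton theta) u v ^+ 2 =
  (1 - u `^ theta * (1 - v `^ (- theta))) `^ (- (2 + 2 / theta)).
Proof.
move=> u01 v01; rewrite partial1_clayton//; have /andP[u0 _] := u01.
have X0 : 0 <= u `^ (- theta) + v `^ (- theta) - 1.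
  by rewrite -addrA addr_ge0 ?powR_ge0// subr_ge0 powRN_ge1.
have -> : 1 - u `^ theta * (1 - v `^ (- theta)) =
    u `^ theta * (u `^ (- theta) + v `^ (- theta) - 1).
  by rewrite (powRN u); field; rewrite gt_eqF// powR_gt0.
rewrite powRM ?powR_ge0// exprMn -!powR_mulrn ?powR_ge0// -!powRrM mulrC.
by congr (_ `^ _ * _ `^ _); field; rewrite gt_eqF.
Qed.

Lemma integral_partial1_clayton_sqr v : 0 < v < 1 ->
  \int[mu]_(u in `]0, 1[) (partial1 (clayton theta) u v ^+ 2) =
  hyp2F1 (1 / theta) (2 + 2 / theta) (1 + 1 / theta) (1 - v `^ (- theta)).
Proof.
move=> v01; have a0 : 0 < 1 / theta by rewrite divr_gt0.
pose z := 1 - v `^ (- theta); pose b := 2 + 2 / theta; pose a := 1 / theta.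
have z0 : z <= 0 by rewrite subr_le0 powRN_ge1.
rewrite /hyp2F1 -/z -/b -/a.
have -> : 1 + a - a = 1 by rewrite addrK.
rewrite subrr addrC GammaD1// Gamma1 mulr1 mulfK ?gt_eqF ?Gamma_gt0//.
pose G u := (1 - u `^ theta * z) `^ (- b).
have mG : measurable_fun setT G.
  apply: (measurableT_comp (measurable_powRl R (- b))).
  by apply: measurable_funB => //; exact: measurable_funM.
have mH : measurable_fun setT (fun w => w `^ (a - 1) * (1 - w * z) `^ (- b)).
  apply: measurable_funM => //.
  apply: (measurableT_comp (measurable_powRl R (- b))).
  by apply: measurable_funB => //; exact: measurable_funM.
(* Since [z <= 0], the base is at least 1, so the power is differentiable there. *)
have cG : {in `]0, +oo[, continuous G}.
  move=> u; rewrite in_itv/= andbT => u0.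
  pose g (y : R) := 1 - y `^ theta * z.
  have gu0 : 0 < g u.
    by rewrite /g subr_gt0 (le_lt_trans _ ltr01)// mulr_ge0_le0 ?powR_ge0.
  have dpow := is_derive1_powR theta u0.
  have dg := is_deriveB (is_derive_cst (1 : R) u 1)
    (is_deriveM dpow (is_derive_cst z u 1)).
  apply: differentiable_continuous; apply/derivable1_diffP.
  by have [] := is_derive1_comp (is_derive1_powR (- b) gu0) dg.
have -> : \int[mu]_(u in `]0, 1[) (partial1 (clayton theta) u v ^+ 2) =
    \int[mu]_(u in `]0, 1[) G u.
  apply: eq_Rintegral => u; rewrite inE/= in_itv/= => u01.
  exact: partial1_clayton_sqr.
have sub := @ge0_integral_powR_substitution R a 1 G a0 ltr01 mG cG
  (fun u _ => powR_ge0 _ _).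
(* The endpoint 1 is added to match the interval of the substitution lemma, and removed again
   afterwards. *)
rewrite /Rintegral integral_itv_bndo_bndc; last first.
  exact/measurable_EFinP/measurable_funTS.
move: sub; rewrite powR1 => ->.
rewrite -(integral_itv_bndo_bndc
  (f := fun w => (G (w `^ a) * (a * w `^ (a - 1)))%:E)); last first.
  apply/measurable_EFinP/measurable_funTS; apply: measurable_funM.
    exact: (measurableT_comp mG (measurable_powRl R a)).
  exact: measurable_funM.
have -> : (\int[mu]_(w in `]0%R, 1%R[) (G (w `^ a) * (a * w `^ (a - 1)))%:E)%E =
    (a%:E * \int[mu]_(w in `]0%R, 1%R[) (w `^ (a - 1) * (1 - w * z) `^ (- b))%:E)%E.
  rewrite -ge0_integralZl//; last 3 first.
  - exact/measurable_EFinP/measurable_funTS.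
  - by move=> w _; rewrite lee_fin mulr_ge0 ?powR_ge0.
  - by rewrite lee_fin ltW.
  apply: eq_integral => w; rewrite inE/= in_itv/= => /andP[w0 _].
  (* Here [(w ^ a) ^ theta = w] because [a = 1 / theta]. *)
  rewrite -EFinM /G -powRrM /a mul1r mulVf ?gt_eqF// powRr1 1?ltW//.
  by congr EFin; ring.
(* As [c - a - 1 = 0], the factor in [1 - w] of Euler's integrand is 1. *)
under [in RHS]eq_integral do rewrite powRr0 mulr1.
exact: fine_gt0_mulEFin.
Qed.
End clayton.

Theorem mainTheorem7 (R : realType) (theta : R) (theta_gt0 : 0 < theta) :
  chatterjee_xi (clayton theta) =
  6 * (\int[lebesgue_measure]_(v in `]0, 1[)
         hyp2F1 (1 / theta) (2 + 2 / theta) (1 + 1 / theta)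
                (1 - v `^ (- theta))) - 2.
Proof.
rewrite /chatterjee_xi; congr (6 * _ - 2); apply: eq_Rintegral => v.
rewrite inE/= in_itv/=; exact: integral_partial1_clayton_sqr.
Qed.
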